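(* Let $k\ge 2$ be an integer. $\mathsf{BA}_k$ is axiomatized by the universal closures of the axioms (Add), (Ord0), (Ord1), (Mod), (V0), (V1), (V2), (V3), (V4), (V5) listed in the context together with the induction scheme consisting of the universal closures of $$\varphi(\underline 1,\vec y)\wedge\forall^{P_k}d\ (\varphi(d,\vec y)\to\varphi(kd,\vec y))\to\forall^{P_k}d\ \varphi(d,\vec y)$$ for all $\Delta_0$-formulas $\varphi(d,\vec y)$. That is, an $\mathcal L_{\mathsf{BA}}$-sentence is a consequence of these axioms if and only if it belongs to $\mathsf{BA}_k$.
   Context: Fix an integer $k\ge 2$. $\mathcal L_{\mathsf{BA}}=(0,S,+,V_k,\le)$ is a first-order language with equality ($S,V_k$ unary functions, $+$ binary function, $\le$ binary relation); $x<y$ means $x\le y\wedge x\neq y$. The standard model is $\mathbb N$ with the usual $0$, successor, addition and order, where $V_k(x)$ is the largest power of $k$ dividing $x$ for $x>0$, and $V_k(0)=0$. $\mathsf{BA}_k$ is the set of all $\mathcal L_{\mathsf{BA}}$-sentences true in the standard model. Terms: $\underline n=S(S(\dots S(0)\dots))$ ($n$ times); for a term $t$ and $n\in\mathbb N$, $nt=t+(t+(\dots(t+0)\dots))$ ($n$ copies of $t$). A formula is $\Delta_0$ (bounded) if every quantifier in it is of the form $\exists x\le t$ or $\forall x\le t$ with $x$ not occurring in the term $t$ (quantifiers bounded by $<t$ are treated as abbreviations in the usual way). $\varphi(d,\vec y)$ indicates that the free variables of $\varphi$ are among $d,\vec y$. Abbreviations: $P_k(d):\iff d>0\wedge V_k(d)=d$;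 $x\equiv_k y:\iff \exists z\le x+y\ (x=y+kz\vee y=x+kz)$; $\exists^{P_k}d\,\varphi$ means $\exists d\,(P_k(d)\wedge\varphi)$ and $\forall^{P_k}d\,\varphi$ means $\forall d\,(P_k(d)\to\varphi)$, similarly with bounds on $d$. Axioms: (Add) the axioms of discretely ordered commutative cancellative monoids: $+$ is commutative, associative, cancellative with neutral element $0$; $\le$ is a linear order compatible with $+$; $S(x)=x+S(0)$; and $x<y\leftrightarrow S(x)\le y$; (Ord0) $x\ge 0$; (Ord1) $x\le y\leftrightarrow\exists z\le y\,(z+x=y)$; (Mod) $\bigvee_{a=0}^{k-1}(x\equiv_k\underline a)$; (V0) $V_k(0)=0$, $V_k(\underline 1)=\underline 1$; (V1) $V_k(kx)=kV_k(x)$, and $P_k(d)\to\bigwedge_{a=1}^{k-1}(V_k(ad)=d)$; (V2) $(x>0\wedge y>0\wedge V_k(x)<V_k(y))\to V_k(x+y)=V_k(x)$; (V3) $x>0\to\exists y\le x\ \bigvee_{a=1}^{k-1}\big(x=y+aV_k(x)\wedge(V_k(y)>V_k(x)\vee y=0)\big)$; (V4) $x>0\to\exists^{P_k}d\le x\ (d\le x<kd)$; (V5) $V_k(V_k(x))=V_k(x)$. *)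

(* Defs.v *)
From mathcomp Require Import all_boot.

Set Implicit Arguments.
Unset Strict Implicit.
Unset Printing Implicit Defensive.

(* Terms and formulas of the language (0, S, +, V_k, <=) with equality, with de
   Bruijn indices: [tVar i] refers to the i-th enclosing quantifier, and indices
   exceeding the number of enclosing quantifiers are free variables. *)

Inductive term : Type :=
  | tVar of nat
  | tZero
  | tSucc of term
  | tAdd of term & term
  | tV of term.

Inductive formula : Type :=
  | fEq of term & term
  | fLe of term & term
  | fBot
  | fAnd of formula & formula
  | fOr of formula & formula
  | fImp of formula & formula
  | fAll of formula
  | fEx of formula.

Fixpoint tsubst (s : nat -> term) (t : term) : term :=
  match t with
  | tVar i => s i
  | tZero => tZero
  | tSucc t1 => tSucc (tsubst s t1)
  | tAdd t1 t2 => tAdd (tsubst s t1) (tsubst s t2)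
  | tV t1 => tV (tsubst s t1)
  end.

Definition shift (t : term) : term := tsubst (fun i => tVar i.+1) t.

Definition scons (T : Type) (x : T) (s : nat -> T) (i : nat) : T :=
  if i is j.+1 then s j else x.

Definition up (s : nat -> term) : nat -> term :=
  scons (tVar 0) (fun i => shift (s i)).

Fixpoint fsubst (s : nat -> term) (phi : formula) : formula :=
  match phi with
  | fEq t u => fEq (tsubst s t) (tsubst s u)
  | fLe t u => fLe (tsubst s t) (tsubst s u)
  | fBot => fBot
  | fAnd p q => fAnd (fsubst s p) (fsubst s q)
  | fOr p q => fOr (fsubst s p) (fsubst s q)
  | fImp p q => fImp (fsubst s p) (fsubst s q)
  | fAll p => fAll (fsubst (up s) p)
  | fEx p => fEx (fsubst (up s) p)
  end.

(* The least n such that every free variable is < n. *)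
Fixpoint tbound (t : term) : nat :=
  match t with
  | tVar i => i.+1
  | tZero => 0
  | tSucc t1 => tbound t1
  | tAdd t1 t2 => maxn (tbound t1) (tbound t2)
  | tV t1 => tbound t1
  end.

Fixpoint fbound (phi : formula) : nat :=
  match phi with
  | fEq t u | fLe t u => maxn (tbound t) (tbound u)
  | fBot => 0
  | fAnd p q | fOr p q | fImp p q => maxn (fbound p) (fbound q)
  | fAll p | fEx p => (fbound p).-1
  end.

Definition sentence (phi : formula) : Prop := fbound phi = 0.

Definition univ_closure (phi : formula) : formula := iter (fbound phi) fAll phi.

Record structure : Type := Structure {
  carrier :> Type;
  szero : carrier;
  ssucc : carrier -> carrier;
  sadd : carrier -> carrier -> carrier;
  sV : carrier -> carrier;
  sle : carrier -> carrier -> Prop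
}.

Fixpoint teval (M : structure) (v : nat -> M) (t : term) : M :=
  match t with
  | tVar i => v i
  | tZero => szero M
  | tSucc t1 => ssucc (teval v t1)
  | tAdd t1 t2 => sadd (teval v t1) (teval v t2)
  | tV t1 => sV (teval v t1)
  end.

Fixpoint sat (M : structure) (v : nat -> M) (phi : formula) : Prop :=
  match phi with
  | fEq t u => teval v t = teval v u
  | fLe t u => sle (teval v t) (teval v u)
  | fBot => False
  | fAnd p q => sat v p /\ sat v q
  | fOr p q => sat v p \/ sat v q
  | fImp p q => sat v p -> sat v q
  | fAll p => forall x : M, sat (scons x v) p
  | fEx p => exists x : M, sat (scons x v) p
  end.

(* Used for sentences only, whose truth does not depend on the valuation. *)
Definition models (M : structure) (phi : formula) : Prop :=
  forall v : nat -> M, sat v phi.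

Definition consequence (T : formula -> Prop) (phi : formula) : Prop :=
  forall M : structure, (forall psi, T psi -> models M psi) -> models M phi.

(* The largest power of k dividing x, and 0 for x = 0. For k >= 2, every i with
   k ^ i dividing x > 0 satisfies i < x, so the range of i loses nothing. *)
Definition Vfun (k x : nat) : nat :=
  if x == 0 then 0 else \max_(i < x | k ^ i %| x) k ^ i.

Definition standard (k : nat) : structure :=
  @Structure nat 0 S addn (Vfun k) (fun x y => x <= y).

Definition BA (k : nat) (phi : formula) : Prop :=
  sentence phi /\ models (standard k) phi.

Definition num (n : nat) : term := iter n tSucc tZero.

Definition tmul (n : nat) (t : term) : term := iter n (tAdd t) tZero.

Definition fNot (p : formula) : formula := fImp p fBot.
Definition fIff (p q : formula) : formula := fAnd (fImp p q) (fImp q p).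
Definition fLt (t u : term) : formula := fAnd (fLe t u) (fNot (fEq t u)).

Definition bigOr (n m : nat) (F : nat -> formula) : formula :=
  foldr (fun a p => fOr (F a) p) fBot (index_iota n m).
Definition bigAnd (n m : nat) (F : nat -> formula) : formula :=
  foldr (fun a p => fAnd (F a) p) (fNot fBot) (index_iota n m).

(* The bound t lives outside the quantifier; shifting it guarantees that the
   bound variable does not occur in it. *)
Definition fAllLe (t : term) (p : formula) : formula :=
  fAll (fImp (fLe (tVar 0) (shift t)) p).
Definition fExLe (t : term) (p : formula) : formula :=
  fEx (fAnd (fLe (tVar 0) (shift t)) p).

Inductive delta0 : formula -> Prop :=
  | delta0_eq t u : delta0 (fEq t u)
  | delta0_le t u : delta0 (fLe t u)
  | delta0_bot : delta0 fBot
  | delta0_and p q : delta0 p -> delta0 q -> delta0 (fAnd p q)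
  | delta0_or p q : delta0 p -> delta0 q -> delta0 (fOr p q)
  | delta0_imp p q : delta0 p -> delta0 q -> delta0 (fImp p q)
  | delta0_all t p : delta0 p -> delta0 (fAllLe t p)
  | delta0_ex t p : delta0 p -> delta0 (fExLe t p).

Definition Pk (t : term) : formula := fAnd (fLt tZero t) (fEq (tV t) t).
Definition fAllP (p : formula) : formula := fAll (fImp (Pk (tVar 0)) p).

Definition congk (k : nat) (t u : term) : formula :=
  fExLe (tAdd t u)
    (fOr (fEq (shift t) (tAdd (shift u) (tmul k (tVar 0))))
         (fEq (shift u) (tAdd (shift t) (tmul k (tVar 0))))).

(* Induction along the powers of k, for phi(d, y) with d the variable 0 and the
   parameters y the variables 1, 2, etc. In phi(1, y) the parameters are free
   outside any quantifier over d, hence the renumbering by [scons (num 1) tVar]. *)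
Definition indP (k : nat) (phi : formula) : formula :=
  fImp
    (fAnd (fsubst (scons (num 1) tVar) phi)
          (fAllP (fImp phi
             (fsubst (scons (tmul k (tVar 0)) (fun i => tVar i.+1)) phi))))
    (fAllP phi).

(* The axioms as open formulas. At top level x, y, z are the variables 0, 1, 2;
   below a quantifier they become 1, 2, 3 and 0 is the bound variable. *)
Inductive axiom (k : nat) : formula -> Prop :=
  | Add_comm : axiom k
      (fEq (tAdd (tVar 0) (tVar 1)) (tAdd (tVar 1) (tVar 0)))
  | Add_assoc : axiom k
      (fEq (tAdd (tVar 0) (tAdd (tVar 1) (tVar 2)))
           (tAdd (tAdd (tVar 0) (tVar 1)) (tVar 2)))
  | Add_cancel : axiom k
      (fImp (fEq (tAdd (tVar 0) (tVar 2)) (tAdd (tVar 1) (tVar 2)))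
            (fEq (tVar 0) (tVar 1)))
  | Add_zero : axiom k (fEq (tAdd (tVar 0) tZero) (tVar 0))
  | Add_le_refl : axiom k (fLe (tVar 0) (tVar 0))
  | Add_le_anti : axiom k
      (fImp (fAnd (fLe (tVar 0) (tVar 1)) (fLe (tVar 1) (tVar 0)))
            (fEq (tVar 0) (tVar 1)))
  | Add_le_trans : axiom k
      (fImp (fAnd (fLe (tVar 0) (tVar 1)) (fLe (tVar 1) (tVar 2)))
            (fLe (tVar 0) (tVar 2)))
  | Add_le_total : axiom k
      (fOr (fLe (tVar 0) (tVar 1)) (fLe (tVar 1) (tVar 0)))
  | Add_le_add : axiom k
      (fImp (fLe (tVar 0) (tVar 1))
            (fLe (tAdd (tVar 0) (tVar 2)) (tAdd (tVar 1) (tVar 2))))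
  | Add_succ : axiom k
      (fEq (tSucc (tVar 0)) (tAdd (tVar 0) (tSucc tZero)))
  | Add_discrete : axiom k
      (fIff (fLt (tVar 0) (tVar 1)) (fLe (tSucc (tVar 0)) (tVar 1)))
  | Ord0 : axiom k (fLe tZero (tVar 0))
  | Ord1 : axiom k
      (fIff (fLe (tVar 0) (tVar 1))
            (fExLe (tVar 1) (fEq (tAdd (tVar 0) (tVar 1)) (tVar 2))))
  | Mod : axiom k (bigOr 0 k (fun a => congk k (tVar 0) (num a)))
  | V0_zero : axiom k (fEq (tV tZero) tZero)
  | V0_one : axiom k (fEq (tV (num 1)) (num 1))
  | V1_mul : axiom k
      (fEq (tV (tmul k (tVar 0))) (tmul k (tV (tVar 0))))
  | V1_digit : axiom k
      (fImp (Pk (tVar 0))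
            (bigAnd 1 k (fun a => fEq (tV (tmul a (tVar 0))) (tVar 0))))
  | V2 : axiom k
      (fImp (fAnd (fLt tZero (tVar 0))
                  (fAnd (fLt tZero (tVar 1)) (fLt (tV (tVar 0)) (tV (tVar 1)))))
            (fEq (tV (tAdd (tVar 0) (tVar 1))) (tV (tVar 0))))
  | V3 : axiom k
      (fImp (fLt tZero (tVar 0))
            (fExLe (tVar 0) (bigOr 1 k (fun a =>
               fAnd (fEq (tVar 1) (tAdd (tVar 0) (tmul a (tV (tVar 1)))))
                    (fOr (fLt (tV (tVar 1)) (tV (tVar 0)))
                         (fEq (tVar 0) tZero))))))
  | V4 : axiom k
      (fImp (fLt tZero (tVar 0))
            (fExLe (tVar 0)
               (fAnd (Pk (tVar 0))
                     (fAnd (fLe (tVar 0) (tVar 1))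
                           (fLt (tVar 1) (tmul k (tVar 0)))))))
  | V5 : axiom k (fEq (tV (tV (tVar 0))) (tV (tVar 0)))
  | Ind phi : delta0 phi -> axiom k (indP k phi).

Definition axioms (k : nat) (psi : formula) : Prop :=
  exists2 phi, axiom k phi & psi = univ_closure phi.

(* Main.v *)
Require Import Defs.
From mathcomp Require Import all_boot.
From mathcomp Require Import boolp zify.

(** The axioms about V_k are true in N by the decomposition x = k^e * m with k not
    dividing m, for which V_k(x) = k^e; the powers of k are the only numbers that
    satisfy P_k, so the induction scheme holds as well. The content of the theorem
    is that a sentence has the same truth value in all models M of the axioms. This
    is proved with finite automata, but without coding their runs in M.

    By (Mod) and the order axioms, each x in M is k * y + a with a unique y in M
    and a unique digit a < k. A kernel is a finite family of bounded formulas
    (the states) that is closed under appending a least significant digit to all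
    variables: for each state psi and each choice of digits a there is a state
    psi' with psi(k * v + a) <-> psi'(v) in all models. Moreover the truth value
    of psi(0) is required to be the same in all models, which then also holds for
    psi at standard numbers. A relation is regular if it is equivalent, uniformly
    in all models, to a state of a kernel.

    The graphs of addition and of V_k are regular: the states for addition are
    the two carries, and those for V_k come from V_k(k * x) = k * V_k(x) and
    V_k(k * x + a) = 1 for 0 < a < k. Products of kernels treat the connectives.

    The quantifier is the only place where induction is used. The subset
    construction yields the family of the formulas
      exists y, some psi in S holds at (y, v),
    for sets S of states, and two things have to be shown.
    - The truth value at v = 0 is the same in all models ([live_of_model]): if no
      standard y satisfies psi(y, 0), then no y in M does, by induction on the
      power d of k in the statement that no y <= d satisfies any of the states
      that have no standard witness; passing from d to k * d strips one digit.
    - The formulas are equivalent to bounded ones ([small_witness_exists]): there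
      is a standard K such that if all entries of x are at most d, and psi(y, x)
      holds for some y, then it holds for some y < K * d. This is again an
      induction on d, where y is kept bounded by a fixed element of M in order to
      make the induction formula bounded.
    So every formula is regular ([regular_sat]), and a sentence has in every model
    the truth value of a state at 0 ([sentence_absolute]). *)

Set Implicit Arguments.
Unset Strict Implicit.
Unset Printing Implicit Defensive.

(** * Substitution, free variables and finite connectives *)

Definition snum (M : structure) (n : nat) : M := iter n (@ssucc M) (szero M).
Definition smul (M : structure) (n : nat) (x : M) : M :=
  iter n (sadd x) (szero M).

Lemma teval_num (M : structure) (v : nat -> M) n : teval v (num n) = snum M n.
Proof. by elim: n => //= n ->. Qed.

Lemma teval_tmul (M : structure) (v : nat -> M) n t :
  teval v (tmul n t) = smul n (teval v t).
Proof. by elim: n => //= n ->. Qed.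

Lemma teval_tsubst (M : structure) (v : nat -> M) s t :
  teval v (tsubst s t) = teval (fun i => teval v (s i)) t.
Proof. by elim: t => //= [t ->|t -> u ->|t ->]. Qed.

Lemma teval_shift (M : structure) (v : nat -> M) x t :
  teval (scons x v) (shift t) = teval v t.
Proof. by rewrite /shift teval_tsubst. Qed.

Lemma scons_head_tail (T : Type) (v : nat -> T) :
  scons (v 0) (fun i => v i.+1) = v.
Proof. by apply: funext => -[]. Qed.

Lemma teval_up (M : structure) (v : nat -> M) x s :
  (fun i => teval (scons x v) (up s i)) = scons x (fun i => teval v (s i)).
Proof. by apply: funext => -[|i] //=; rewrite teval_shift. Qed.

Lemma sat_fsubst (M : structure) (v : nat -> M) s phi :
  sat v (fsubst s phi) <-> sat (fun i => teval v (s i)) phi.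
Proof.
elim: phi v s => //=.
- by move=> t u v s; rewrite !teval_tsubst.
- by move=> t u v s; rewrite !teval_tsubst.
- by move=> p IHp q IHq v s; rewrite IHp IHq.
- by move=> p IHp q IHq v s; rewrite IHp IHq.
- by move=> p IHp q IHq v s; rewrite IHp IHq.
- by move=> p IHp v s; split=> H x; move: (H x); rewrite IHp teval_up.
- by move=> p IHp v s; split=> -[x H]; exists x; move: H; rewrite IHp teval_up.
Qed.

Lemma teval_agree (M : structure) (v w : nat -> M) t :
  (forall i, i < tbound t -> v i = w i) -> teval v t = teval w t.
Proof.
elim: t => //= [i /(_ i)->//|t IH H|t IHt u IHu H|t IH H]; try by rewrite IH.
by rewrite IHt 1?IHu // => i Hi; apply: H; rewrite leq_max Hi ?orbT.
Qed.

Lemma sat_agree (M : structure) (v w : nat -> M) phi :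
  (forall i, i < fbound phi -> v i = w i) -> sat v phi <-> sat w phi.
Proof.
have scons_agree n (v' w' : nat -> M) x : (forall i, i < n.-1 -> v' i = w' i) ->
    forall i, i < n -> scons x v' i = scons x w' i.
  by move=> H [|i] //= Hi; apply: H; lia.
elim: phi v w => //= [t u|t u|p IHp q IHq|p IHp q IHq|p IHp q IHq|p IHp|p IHp] v w H.
- rewrite (@teval_agree _ v w t) 1?(@teval_agree _ v w u) // => i Hi;
  by apply: H; rewrite leq_max Hi ?orbT.
- rewrite (@teval_agree _ v w t) 1?(@teval_agree _ v w u) // => i Hi;
  by apply: H; rewrite leq_max Hi ?orbT.
- rewrite (IHp v w) 1?(IHq v w) // => i Hi; by apply: H; rewrite leq_max Hi ?orbT.
- rewrite (IHp v w) 1?(IHq v w) // => i Hi; by apply: H; rewrite leq_max Hi ?orbT.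
- rewrite (IHp v w) 1?(IHq v w) // => i Hi; by apply: H; rewrite leq_max Hi ?orbT.
- by split=> Hx x; move: (Hx x); rewrite (IHp _ (scons x w)) //; apply: scons_agree.
- by split=> -[x Hx]; exists x; move: Hx; rewrite (IHp _ (scons x w)) //;
    apply: scons_agree.
Qed.

Lemma models_univ_closure (M : structure) phi :
  models M (univ_closure phi) <-> models M phi.
Proof.
rewrite /univ_closure; elim: (fbound phi) => //= n <-; split=> H v //=.
by rewrite -(scons_head_tail v); apply: H.
Qed.

Lemma sat_foldr_or (M : structure) (v : nat -> M) (I : eqType) F (s : seq I) :
  sat v (foldr (fun a p => fOr (F a) p) fBot s) <->
  exists2 a, a \in s & sat v (F a).
Proof.
elim: s => [|b s IH]; first by split=> // -[a]; rewrite in_nil.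
rewrite /= IH; split=> [[H|[a Ha H]]|[a]].
- by exists b; rewrite ?mem_head.
- by exists a; rewrite // in_cons Ha orbT.
- by rewrite in_cons => /orP[/eqP->|Ha H]; [left | right; exists a].
Qed.

Lemma sat_foldr_and (M : structure) (v : nat -> M) (I : eqType) F (s : seq I) :
  sat v (foldr (fun a p => fAnd (F a) p) (fNot fBot) s) <->
  forall a, a \in s -> sat v (F a).
Proof.
elim: s => [|b s IH]; first by split=> // _ [].
rewrite /= IH; split=> [[Hb H] a|H].
  by rewrite in_cons => /orP[/eqP->//|]; apply: H.
by split=> [|a Ha]; apply: H; rewrite in_cons ?eqxx ?Ha ?orbT.
Qed.

Lemma sat_bigOr (M : structure) (v : nat -> M) n m F :
  sat v (bigOr n m F) <-> exists2 a, n <= a < m & sat v (F a).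
Proof.
rewrite sat_foldr_or; split=> -[a]; first by rewrite mem_index_iota; exists a.
by exists a; rewrite ?mem_index_iota.
Qed.

Lemma sat_bigAnd (M : structure) (v : nat -> M) n m F :
  sat v (bigAnd n m F) <-> forall a, n <= a < m -> sat v (F a).
Proof.
rewrite sat_foldr_and; split=> H a; first by rewrite -mem_index_iota; apply: H.
by rewrite mem_index_iota; apply: H.
Qed.

Definition fDisj (Q : finType) (S : {set Q}) (psi : Q -> formula) : formula :=
  foldr (fun q p => fOr (psi q) p) fBot (enum S).
Definition fConj (Q : finType) (S : {set Q}) (psi : Q -> formula) : formula :=
  foldr (fun q p => fAnd (psi q) p) (fNot fBot) (enum S).

Lemma sat_disj (M : structure) (v : nat -> M) (Q : finType) (S : {set Q}) psi :
  sat v (fDisj S psi) <-> exists2 q, q \in S & sat v (psi q).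
Proof.
by rewrite sat_foldr_or; split=> -[q qS H]; exists q; rewrite ?mem_enum // in qS *.
Qed.

Lemma sat_conj (M : structure) (v : nat -> M) (Q : finType) (S : {set Q}) psi :
  sat v (fConj S psi) <-> forall q, q \in S -> sat v (psi q).
Proof.
by rewrite sat_foldr_and; split=> H q Hq; apply: H; rewrite ?mem_enum // in Hq *.
Qed.

Lemma delta0_disj (Q : finType) (S : {set Q}) psi :
  (forall q, delta0 (psi q)) -> delta0 (fDisj S psi).
Proof. by move=> H; rewrite /fDisj; elim: (enum S) => //= *; constructor. Qed.

Lemma delta0_conj (Q : finType) (S : {set Q}) psi :
  (forall q, delta0 (psi q)) -> delta0 (fConj S psi).
Proof.
move=> H; rewrite /fConj; elim: (enum S) => /= [|*]; last by constructor.
by constructor; constructor.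
Qed.

Lemma tsubst_up_shift s t :
  tsubst (up s) (shift t) = shift (tsubst s t).
Proof. by rewrite /shift; elim: t => //= [t ->|t -> u ->|t ->]. Qed.

Lemma delta0_fsubst s phi : delta0 phi -> delta0 (fsubst s phi).
Proof.
move=> H; elim: H s => //= *; try by constructor.
- by rewrite tsubst_up_shift -/(fAllLe _ _); constructor.
- by rewrite tsubst_up_shift -/(fExLe _ _); constructor.
Qed.

Lemma sat_fAllLe (M : structure) (v : nat -> M) t p :
  sat v (fAllLe t p) <-> forall x, sle x (teval v t) -> sat (scons x v) p.
Proof. by split=> /= H x; move: (H x); rewrite /= teval_shift. Qed.

Lemma sat_fExLe (M : structure) (v : nat -> M) t p :
  sat v (fExLe t p) <-> exists2 x, sle x (teval v t) & sat (scons x v) p.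
Proof.
split=> /= -[x]; first by rewrite teval_shift => -[]; exists x.
by rewrite -(teval_shift v x); exists x.
Qed.

(** A block of n quantifiers with the same bound; the bound is shifted once for
    each of them, so the variables of the block are 0, ..., n - 1. *)
Fixpoint fAllLes (n : nat) (t : term) (p : formula) : formula :=
  if n is n1.+1 then fAllLe t (fAllLes n1 (shift t) p) else p.

Definition prefix_val (T : Type) (n : nat) (x v : nat -> T) (i : nat) : T :=
  if i < n then x i else v (i - n).

Lemma sat_fAllLes (M : structure) (v : nat -> M) n t p :
  sat v (fAllLes n t p) <->
  forall x : nat -> M, (forall i, i < n -> sle (x i) (teval v t)) ->
    sat (prefix_val n x v) p.
Proof.
elim: n v t => [|n IH] v t.
  have E x : prefix_val 0 x v = v.
    by apply: funext => i; rewrite /prefix_val ltn0 subn0.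
  by split=> [H x|/(_ v)]; rewrite E //; apply.
rewrite [fAllLes _ _ _]/= sat_fAllLe; split=> H.
  move=> x Hx; move: (H (x n) (Hx _ (leqnn _))); rewrite IH teval_shift => /(_ x).
  have -> : prefix_val n x (scons (x n) v) = prefix_val n.+1 x v.
    apply: funext => i; rewrite /prefix_val ltnS.
    case: (ltngtP i n) => [//| |->]; last by rewrite subnn.
    by move=> lt_ni; rewrite -(subnSK lt_ni).
  by apply=> i Hi; apply: Hx; apply: ltnW.
move=> z Hz; rewrite IH teval_shift => x Hx.
pose x' i := if i == n then z else x i.
have -> : prefix_val n x (scons z v) = prefix_val n.+1 x' v.
  apply: funext => i; rewrite /prefix_val ltnS /x'.
  case: (ltngtP i n) => [//| |->]; last by rewrite subnn.
  by move=> lt_ni; rewrite -(subnSK lt_ni).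
apply: H => i; rewrite ltnS /x'; case: (ltngtP i n) => // lt_in _; exact: Hx.
Qed.

Lemma delta0_fAllLes n t p : delta0 p -> delta0 (fAllLes n t p).
Proof. by elim: n t => //= n IH t Hp; constructor; apply: IH. Qed.

(** * The standard model satisfies the axioms *)

Section StandardModel.
Variables (k : nat) (hk : 2 <= k).
Let k_gt0 : 0 < k := ltnW hk.

(** The base k need not be prime, so this replaces the p-adic valuation. *)
Lemma power_decomposition x :
  0 < x -> exists e m, [/\ x = k ^ e * m, ~~ (k %| m) & 0 < m].
Proof.
elim/ltn_ind: x => x IH x0; case: (boolP (k %| x)) => [kx|nkx]; last first.
  by exists 0, x; rewrite mul1n.
have [||e [m [E nkm m0]]] := IH (x %/ k).
- by rewrite ltn_Pdiv.
- by rewrite divn_gt0 // dvdn_leq.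
by exists e.+1, m; rewrite -{1}(divnK kx) E expnSr mulnAC.
Qed.

Lemma dvdn_exp_mul i e m : ~~ (k %| m) -> (k ^ i %| k ^ e * m) = (i <= e).
Proof.
move=> nkm; case: (leqP i e) => [le_ie|lt_ei].
  by rewrite dvdn_mulr // dvdn_exp2l.
rewrite -(subnKC lt_ei) expnD expnSr -mulnA dvdn_pmul2l ?expn_gt0 ?k_gt0 //.
by apply: contraNF nkm; apply: dvdn_trans; apply: dvdn_mulr.
Qed.

Lemma Vfun_exp_mul e m : ~~ (k %| m) -> Vfun k (k ^ e * m) = k ^ e.
Proof.
move=> nkm; have m0 : 0 < m by rewrite lt0n; apply: contraNneq nkm => ->.
have ke0 : 0 < k ^ e by rewrite expn_gt0 k_gt0.
rewrite /Vfun gtn_eqF ?muln_gt0 ?ke0 //; apply/eqP.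
rewrite eqn_leq; apply/andP; split.
  by apply/bigmax_leqP => i; rewrite dvdn_exp_mul // => ?; rewrite leq_exp2l.
have lt_e : e < k ^ e * m.
  by apply: leq_trans (ltn_expl e hk) _; rewrite leq_pmulr.
apply: (@leq_bigmax_cond _ (fun i : 'I_(k ^ e * m) => k ^ i %| k ^ e * m)
  (fun i => k ^ i) (Ordinal lt_e)).
by rewrite /= dvdn_mulr.
Qed.

Lemma Vfun_exp e : Vfun k (k ^ e) = k ^ e.
Proof. by rewrite -[in LHS](muln1 (k ^ e)) Vfun_exp_mul // dvdn1 gtn_eqF. Qed.

Lemma Vfun_fixpoint d : 0 < d -> Vfun k d = d -> exists e, d = k ^ e.
Proof.
move=> /power_decomposition[e [m [-> nkm _]]]; rewrite Vfun_exp_mul //.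
by move=> {1}<-; exists e.
Qed.

Lemma Vfun_ge j y : 0 < y -> k ^ j %| y -> k ^ j <= Vfun k y.
Proof.
move=> /power_decomposition[e [m [-> nkm _]]]; rewrite Vfun_exp_mul //.
by rewrite dvdn_exp_mul // leq_exp2l.
Qed.

Let N := standard k.

Lemma snum_standard n : snum N n = n.
Proof. by elim: n => //= n ->. Qed.

Lemma smul_standard n (x : nat) : @smul N n x = n * x.
Proof. by elim: n => //= n ->; rewrite mulSn. Qed.

Lemma sat_Pk (v : nat -> N) t :
  sat v (Pk t) <-> exists e, teval v t = k ^ e.
Proof.
split=> /= [[[_ ne0] Vt]|[e ->]]; first by apply: Vfun_fixpoint; lia.
by split; [split=> //; have := expn_gt0 k e; lia | exact: Vfun_exp].
Qed.

Lemma standard_axiom phi : axiom k phi -> models N phi.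
Proof.
case=> {phi}.
- by move=> v /=; lia.
- by move=> v /=; lia.
- by move=> v /=; lia.
- by move=> v /=; lia.
- by move=> v /=; lia.
- by move=> v /=; lia.
- by move=> v /=; lia.
- by move=> v /=; lia.
- by move=> v /=; lia.
- by move=> v /=; lia.
- by move=> v /=; lia.
- by move=> v /=; lia.
- move=> v /=; split=> [H|[z]]; last by lia.
  by exists (v 1 - v 0); split; lia.
- move=> v; apply/sat_bigOr; exists (v 0 %% k); first by rewrite ltn_mod k_gt0.
  apply/sat_fExLe; exists (v 0 %/ k) => /=.
    by apply: leq_trans (leq_div _ _) _; apply: leq_addr.
  left; rewrite teval_shift teval_num snum_standard teval_tmul smul_standard /=.
  by rewrite addnC mulnC -divn_eq.
- by [].
- by move=> v /=; apply: (Vfun_exp 0).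
- move=> v /=; rewrite !teval_tmul !smul_standard /=.
  have [E0|x0] := posnP (v 0); first by rewrite E0 !muln0 /Vfun /= ?muln0.
  have [e [m [-> nkm m0]]] := power_decomposition x0.
  by rewrite mulnA -expnS !Vfun_exp_mul // expnS.
- move=> v /= [[_ ne0] Vd]; apply/sat_bigAnd => a /andP[a1 ak] /=.
  rewrite teval_tmul smul_standard /=.
  have [|e ->] := Vfun_fixpoint _ Vd; first by lia.
  by rewrite mulnC Vfun_exp_mul // gtnNdvd.
- move=> v /= [[_ x0] [[_ y0] [lt_V ne_V]]].
  have [|e [m [Ex nkm m0]]] := @power_decomposition (v 0); first by lia.
  have [|f [l [Ey nkl l0]]] := @power_decomposition (v 1); first by lia.
  move: lt_V ne_V; rewrite Ex Ey !Vfun_exp_mul // => le_V ne_V.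
  have lt_ef : e < f by rewrite -(ltn_exp2l _ _ hk) ltn_neqAle le_V andbT; apply/eqP.
  rewrite -(subnKC lt_ef) expnD expnSr -!mulnA -mulnDr Vfun_exp_mul //.
  by rewrite dvdn_addl // dvdn_mulr.
- move=> v /= [_ x0].
  have [|e [m [Ex nkm m0]]] := @power_decomposition (v 0); first by lia.
  exists (k ^ e * (m - m %% k)); split.
    by rewrite Ex leq_mul2l leq_subr orbT.
  apply/sat_bigOr; exists (m %% k); first by rewrite lt0n ltn_mod k_gt0 andbT.
  rewrite /= teval_tmul smul_standard /= Ex Vfun_exp_mul //; split.
    by rewrite (mulnC (m %% k)) -mulnDr subnK // leq_mod.
  set y := k ^ e * _; have [->|y0] := posnP y; [by right | left].
  suff : k ^ e < Vfun k y by lia.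
  rewrite (@leq_trans (k ^ e.+1)) ?ltn_exp2l // Vfun_ge // expnSr dvdn_mul //.
  by rewrite {1}(divn_eq m k) addnK dvdn_mull.
- move=> v /= [_ x0]; have x_gt0 : 0 < v 0 by lia.
  have /andP[le_e lt_e] := trunc_log_bounds hk x_gt0.
  exists (k ^ trunc_log k (v 0)); split=> //; split.
    apply: (proj2 (@sat_Pk (scons (k ^ trunc_log k (v 0) : N) v) (tVar 0))).
    by exists (trunc_log k (v 0)).
  by rewrite teval_tmul smul_standard /= -expnS; split=> //; lia.
- move=> v /=; have [->//|x0] := posnP (v 0).
  have [e [m [-> nkm m0]]] := power_decomposition x0.
  by rewrite !Vfun_exp_mul // Vfun_exp.
(* In N the induction scheme holds for every formula, since the elements
   satisfying P_k are the k ^ e and one can use induction on e. *)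
- move=> phi _ v [/sat_fsubst H1 HS] d Pd.
  have [e /= ->] := proj1 (@sat_Pk (scons d v) (tVar 0)) Pd.
  elim: e => [|e IH].
    by congr sat: H1; apply: funext => -[].
  have Pe := proj2 (@sat_Pk (scons (k ^ e : N) v) (tVar 0)) (ex_intro _ e erefl).
  have /sat_fsubst := HS (k ^ e) Pe IH.
  by congr sat; apply: funext => -[|i] //=; rewrite teval_tmul smul_standard /= expnS.
Qed.

End StandardModel.

(** * Arithmetic in an arbitrary model *)

Definition model (k : nat) (M : structure) : Prop :=
  forall psi, axioms k psi -> models M psi.

Lemma standard_model k : 2 <= k -> model k (standard k).
Proof.
move=> hk _ [phi Hphi ->]; rewrite models_univ_closure; exact: standard_axiom.
Qed.

Section ModelArithmetic.
Variables (k : nat) (hk : 2 <= k) (M : structure) (HM : model k M).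
Implicit Types x y z d : M.

Let k_gt0 : 0 < k := ltnW hk.

Let ax phi (v : nat -> M) : axiom k phi -> sat v phi.
Proof.
by move=> Hphi; move: v; apply/models_univ_closure; apply: HM; exists phi.
Qed.

Let val3 x y z : nat -> M := scons x (scons y (fun _ => z)).

Local Notation "0" := (szero M).
Local Notation "x + y" := (@sadd M x y).
Local Notation "x <= y" := (@sle M x y).
Local Notation S := (@ssucc M).
Local Notation V := (@sV M).
Local Notation num := (snum M).
Local Notation "n ** x" := (@smul M n x) (at level 40).

Lemma sadd_comm x y : x + y = y + x.
Proof. exact: (ax (val3 x y y) (Add_comm k)). Qed.

Lemma sadd_assoc x y z : x + (y + z) = x + y + z.
Proof. exact: (ax (val3 x y z) (Add_assoc k)). Qed.

Lemma sadd_cancel x y z : x + z = y + z -> x = y.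
Proof. exact: (ax (val3 x y z) (Add_cancel k)). Qed.

Lemma sadd_zero x : x + 0 = x.
Proof. exact: (ax (val3 x x x) (Add_zero k)). Qed.

Lemma szero_add x : 0 + x = x.
Proof. by rewrite sadd_comm sadd_zero. Qed.

Let addAC x y z : x + y + z = x + z + y.
Proof. by rewrite -sadd_assoc (sadd_comm y) sadd_assoc. Qed.

Let addACA x y z t : x + y + (z + t) = (x + z) + (y + t).
Proof. by rewrite !sadd_assoc (addAC x y). Qed.

Lemma sle_refl x : x <= x.
Proof. exact: (ax (val3 x x x) (Add_le_refl k)). Qed.

Lemma sle_anti x y : x <= y -> y <= x -> x = y.
Proof. by move=> H1 H2; apply: (ax (val3 x y x) (Add_le_anti k)); split. Qed.

Lemma sle_trans y x z : x <= y -> y <= z -> x <= z.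
Proof. by move=> H1 H2; apply: (ax (val3 x y z) (Add_le_trans k)); split. Qed.

Let le_total x y : x <= y \/ y <= x.
Proof. exact: (ax (val3 x y y) (Add_le_total k)). Qed.

Let le_addr x y z : x <= y -> x + z <= y + z.
Proof. exact: (ax (val3 x y z) (Add_le_add k)). Qed.

Lemma ssuccE x : S x = x + num 1.
Proof. exact: (ax (val3 x x x) (Add_succ k)). Qed.

Let ltP x y : (x <= y /\ x <> y) <-> S x <= y.
Proof.
have [H1 H2] := ax (val3 x y y) (Add_discrete k).
by split=> [[le_xy ne_xy]|/H2[]]; [apply: H1 | split].
Qed.

Lemma sle0x x : 0 <= x.
Proof. exact: (ax (val3 x x x) (Ord0 k)). Qed.

Lemma sle_add_exists x y : x <= y <-> exists z, y = z + x.
Proof.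
have [H1 H2] := ax (val3 x y y) (Ord1 k).
split=> [/H1[z [_ /= E]]|[z ->]]; first by exists z.
by rewrite -{1}(szero_add x); exact/le_addr/sle0x.
Qed.

Let lt_irrefl x : ~ S x <= x.
Proof. by case/ltP. Qed.

Let le_or_lt x y : x <= y \/ S y <= x.
Proof.
have [|le_yx] := le_total x y; first by left.
have [->|ne_yx] := EM (y = x); first by left; apply: sle_refl.
by right; apply/ltP.
Qed.

Lemma sle_addn z x : x <= z + x.
Proof. by apply/sle_add_exists; exists z. Qed.

Lemma snumD m n : num (m + n)%N = num m + num n.
Proof.
elim: m => [|m IH]; first by rewrite szero_add.
by rewrite addSn [LHS]/= [num m.+1]/= IH !ssuccE addAC.
Qed.

Lemma snum_le m n : (m <= n)%N -> num m <= num n.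
Proof. by move=> /subnK<-; rewrite snumD; apply: sle_addn. Qed.

Lemma snum_inj m n : num m = num n -> m = n.
Proof.
suff lt_neq a b : (a < b)%N -> num a <> num b.
  by move=> E; case: (ltngtP m n) => // /lt_neq; rewrite E.
by move=> /snum_le; rewrite [num a.+1]/= => /ltP[].
Qed.

Lemma sle_snum n x : x <= num n -> exists2 b, (b <= n)%N & x = num b.
Proof.
elim: n => [|n IH] le_xn; first by exists 0%N => //; exact/sle_anti/sle0x.
have [/IH[b le_bn ->]|lt_nx] := le_or_lt x (num n); first by exists b; rewrite ?leqW.
by exists n.+1 => //; apply: sle_anti.
Qed.

Let mulD n x y : n ** (x + y) = n ** x + n ** y.
Proof.
elim: n => [|n IH]; first by rewrite sadd_zero.
by rewrite [LHS]/= IH addACA.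
Qed.

Let mulDn m n x : (m + n) ** x = m ** x + n ** x.
Proof.
elim: m => [|m IH]; first by rewrite szero_add.
by rewrite addSn [LHS]/= IH sadd_assoc.
Qed.

Lemma smul_snum n m : n ** num m = num (n * m).
Proof. by elim: n => // n IH; rewrite [LHS]/= IH -snumD mulSn. Qed.

Lemma smul_zero n : n ** 0 = 0.
Proof. by rewrite (smul_snum n 0) muln0. Qed.

Let mulA m n x : m ** (n ** x) = (m * n) ** x.
Proof. by elim: m => // m IH; rewrite [LHS]/= IH mulSn mulDn. Qed.

Lemma smul_le n x y : x <= y -> n ** x <= n ** y.
Proof.
by move=> /sle_add_exists[z ->]; rewrite mulD; apply: sle_addn.
Qed.

(** In the second case of the congruence, a = x + k * z, the element x is below a
    standard number, hence standard itself, and it is its own remainder. *)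
Lemma euclid_exists x : exists y a, (a < k)%N /\ x = k ** y + num a.
Proof.
have /sat_bigOr[a /andP[_ lt_ak]] := ax (val3 x x x) (Mod k).
move=> /sat_fExLe[z _] /=; rewrite teval_shift teval_num teval_tmul /=.
case=> [->|Ea]; first by exists z, a; rewrite sadd_comm.
have /sle_snum[b le_ba ->] : x <= num a.
  by apply/sle_add_exists; exists (k ** z); rewrite sadd_comm.
by exists 0, b; rewrite smul_zero szero_add; split=> //; apply: leq_ltn_trans lt_ak.
Qed.

(** Comparing quotients: the remainder a of the smaller side cannot make up for
    a difference of the quotients, since it is less than k. *)
Lemma le_quotient x y a b :
  (b < k)%N -> k ** x + num a <= k ** y + num b -> x <= y.
Proof.
move=> lt_bk le_xy; have [//|/sle_add_exists[z Ex]] := le_or_lt x y.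
case: (@lt_irrefl (k ** y + num b)); apply: sle_trans le_xy.
have -> : S (k ** y + num b) = k ** y + num b.+1.
  by rewrite ssuccE -sadd_assoc -snumD addn1.
apply/sle_add_exists; exists (k ** z + num a + num (k - b.+1)).
rewrite Ex mulD ssuccE mulD smul_snum muln1 -{3}(subnKC lt_bk) snumD.
by rewrite addAC (sadd_assoc (k ** y)) (sadd_comm _ (num (k - _))) sadd_assoc.
Qed.

Lemma euclid_unique x y a b : (a < k)%N -> (b < k)%N ->
  k ** x + num a = k ** y + num b -> x = y /\ a = b.
Proof.
move=> lt_ak lt_bk E; have Exy : x = y.
  apply: sle_anti; first by apply: (@le_quotient _ _ a b lt_bk); rewrite E; apply: sle_refl.
  by apply: (@le_quotient _ _ b a lt_ak); rewrite E; apply: sle_refl.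
split=> //; apply: snum_inj; move: E; rewrite Exy !(sadd_comm (k ** y)); exact: sadd_cancel.
Qed.

(** One step of the addition of numbers in base k with incoming carry c and
    outgoing carry (a + b + c) %/ k *)
Lemma add_digits x y z a b c e : (e < k)%N ->
  k ** z + num e = k ** x + num a + (k ** y + num b) + num c <->
  e = (a + b + c) %% k /\ z = x + y + num ((a + b + c) %/ k).
Proof.
move=> lt_ek; set t := (a + b + c)%N.
have -> : k ** x + num a + (k ** y + num b) + num c =
    k ** (x + y + num (t %/ k)) + num (t %% k).
  rewrite addACA -snumD -sadd_assoc -snumD -/t {1}(divn_eq t k) snumD sadd_assoc -mulD.
  by rewrite (mulnC _ k) -smul_snum -mulD.
split=> [/euclid_unique[]|[-> ->]] //; by rewrite ltn_mod k_gt0.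
Qed.

Lemma sV_zero : V 0 = 0.
Proof. exact: (ax (val3 0 0 0) (V0_zero k)). Qed.

Lemma sV_mul x : V (k ** x) = k ** V x.
Proof. by have := ax (val3 x x x) (V1_mul k); rewrite /= !teval_tmul. Qed.

(** The reading of P_k(d) in a structure *)
Definition is_power d : Prop := (0 <= d /\ 0 <> d) /\ V d = d.

Lemma is_power_one : is_power (num 1).
Proof.
split; last exact: (ax (val3 0 0 0) (V0_one k)).
by split=> [|/(@snum_inj 0 1)//]; apply: sle0x.
Qed.

Lemma is_power_mul d : is_power d -> is_power (k ** d).
Proof.
move=> [[_ d0] Vd]; split; last by rewrite sV_mul Vd.
split=> [|E]; first exact: sle0x.
apply: d0; apply: sle_anti; first exact: sle0x.
by rewrite E -(prednK k_gt0) /= sadd_comm; apply: sle_addn.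
Qed.

(** If V_k(x) were 0, then the y of axiom (V3) would be x itself, which (V3)
    excludes. *)
Let V_gt0 x : 0 <> x -> S 0 <= V x.
Proof.
move=> x0; have /= := ax (val3 x x x) (V3 k).
have [|Vx0] := le_or_lt (V x) 0; last by [].
move=> /sle_anti /(_ (sle0x _)) Vx0; case=> [|y [_] /sat_bigOr[a _] /=].
  by split; first exact: sle0x.
rewrite teval_tmul /= Vx0 smul_zero sadd_zero => -[<-].
by case=> [[_]|/esym//]; rewrite Vx0 => /(_ erefl).
Qed.

Let V_num a : (0 < a < k)%N -> V (num a) = num 1.
Proof.
move=> Ha; have /sat_bigAnd := ax (val3 (num 1) 0 0) (V1_digit k) is_power_one.
by move=> /(_ _ Ha); rewrite /= teval_tmul -[_ ** _]/(a ** num 1) smul_snum muln1.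
Qed.

(** For x > 0 this is axiom (V2), as V_k(a) = 1 < k * V_k(x) = V_k(k * x). *)
Lemma sV_digit x a : (0 < a < k)%N -> V (k ** x + num a) = num 1.
Proof.
move=> Ha; have [<-|x0] := EM (0 = x); first by rewrite smul_zero szero_add V_num.
have lt1 : num 2 <= k ** V x.
  apply: (@sle_trans (k ** num 1)); first by rewrite smul_snum muln1; apply: snum_le.
  exact/smul_le/V_gt0.
have a0 : 0 <> num a by move=> /(@snum_inj 0 a); lia.
have kx0 : 0 <> k ** x.
  move=> E; move: lt1; rewrite -sV_mul -E sV_zero => /(sle_anti (sle0x _)).
  by move=> /(@snum_inj 0 2).
rewrite sadd_comm -(V_num Ha); apply: (ax (val3 (num a) (k ** x) 0) (V2 k)).
rewrite /= (V_num Ha) sV_mul; split; first by split=> //; apply: sle0x.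
split; first by split=> //; apply: sle0x.
exact: (proj2 (ltP (num 1) _) lt1).
Qed.

(** The upper bound is a term in x, which makes it possible to bound witnesses by
    terms in the free variables. *)
Lemma power_cover x : exists d, [/\ is_power d, x <= d & d <= k ** x + num 1].
Proof.
have [<-|x0] := EM (0 = x).
  exists (num 1); rewrite smul_zero szero_add.
  by split; [apply: is_power_one | apply: sle0x | apply: sle_refl].
have [|d /= [_ [Pd [le_dx]]]] := ax (val3 x 0 0) (V4 k).
  by split=> //; apply: sle0x.
rewrite teval_tmul /= => -[le_xd _].
exists (k ** d); split=> //; first exact: is_power_mul.
apply: sle_trans (smul_le k le_dx) _; rewrite sadd_comm; exact: sle_addn.
Qed.

Lemma power_induction (phi : formula) (v : nat -> M) : delta0 phi ->
  sat (scons (num 1) v) phi ->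
  (forall d, is_power d -> sat (scons d v) phi -> sat (scons (k ** d) v) phi) ->
  forall d, is_power d -> sat (scons d v) phi.
Proof.
move=> Dphi H1 HS; have := ax v (Ind k Dphi); apply; split.
  by apply/sat_fsubst; congr sat: H1; apply: funext => -[].
move=> d Pd Hd; apply/sat_fsubst; congr sat: (HS d Pd Hd).
by apply: funext => -[] //=; rewrite teval_tmul.
Qed.

Lemma quotient_le_power d y b : (b < k)%N -> k ** y + num b <= k ** d -> y <= d.
Proof.
move=> lt_bk H; apply: (@le_quotient _ _ b 0 k_gt0).
by rewrite [_ + num 0]sadd_zero.
Qed.

(** A strict bound is preserved by appending a digit if d is multiplied by k; a
    weak one would not be. *)
Lemma append_digit_lt y d K b : (b < k)%N ->
  S y <= K ** d -> S (k ** y + num b) <= K ** (k ** d).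
Proof.
move=> lt_bk /(smul_le k); rewrite mulA mulnC -mulA; apply: sle_trans.
rewrite !ssuccE mulD smul_snum muln1 -sadd_assoc -snumD addn1.
by rewrite sadd_comm [X in _ <= X]sadd_comm; apply/le_addr/snum_le.
Qed.

Lemma quotient_le y b : y <= k ** y + num b.
Proof. by rewrite -(prednK k_gt0) /= -sadd_assoc sadd_comm; apply: sle_addn. Qed.

End ModelArithmetic.

(** * Regular relations *)

Section Regular.
Variables (k : nat) (hk : 2 <= k).
Let k_gt0 : 0 < k := ltnW hk.
Local Notation N := (standard k).

Definition zero_val (M : structure) : nat -> M := fun _ => szero M.

Definition append_digit (M : structure) (v : nat -> M) (a : nat -> nat) : nat -> M :=
  fun i => sadd (smul k (v i)) (snum M (a i)).

Definition is_digits (a : nat -> nat) : Prop := forall i, a i < k.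

(** q is what p says about the quotients of the variables by k, once their least
    significant digits a have been read: a Brzozowski derivative of p. *)
Definition derivative (a : nat -> nat) (p q : formula) : Prop :=
  forall (M : structure) (v : nat -> M), model k M ->
    sat (append_digit v a) p <-> sat v q.

(** The transition structure of a deterministic automaton that reads the least
    significant digits first, each state being given by a bounded formula that
    says that the input is accepted from there. The predicate F is the set of
    accepting states; its independence of M is what makes truth absolute. *)
Definition kernel (Q : finType) (psi : Q -> formula) : Prop :=
  [/\ forall q, delta0 (psi q),
      forall a q, is_digits a -> exists q', derivative a (psi q) (psi q') &
      exists F : Q -> Prop, forall (M : structure) q, model k M ->
        sat (zero_val M) (psi q) <-> F q].

Definition regular (R : forall M : structure, (nat -> M) -> Prop) : Prop :=
  exists (Q : finType) (psi : Q -> formula) (q0 : Q), kernel psi /\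
    forall (M : structure) (v : nat -> M), model k M -> R M v <-> sat v (psi q0).

Lemma regular_ext (R1 R2 : forall M : structure, (nat -> M) -> Prop) :
  (forall (M : structure) (v : nat -> M), model k M -> R1 M v <-> R2 M v) ->
  regular R1 -> regular R2.
Proof.
move=> E [Q [psi [q0 [K H]]]]; exists Q, psi, q0; split=> // M v HM.
by rewrite -E // H.
Qed.

Lemma is_digits_scons b a : b < k -> is_digits a -> is_digits (scons b a).
Proof. by move=> Hb Ha [|i] //=; apply: Ha. Qed.

Lemma append_digit_scons (M : structure) (y : M) v b a :
  append_digit (scons y v) (scons b a) =
  scons (sadd (smul k y) (snum M b)) (append_digit v a).
Proof. by apply: funext => -[]. Qed.

Lemma append_digit_zero (M : structure) a :
  model k M -> append_digit (zero_val M) a = fun i => snum M (a i).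
Proof.
move=> HM; apply: funext => i.
by rewrite /append_digit (smul_zero HM) (szero_add HM).
Qed.

(** The product automaton *)
Lemma regular_connective (fop : formula -> formula -> formula)
    (op : Prop -> Prop -> Prop) R1 R2 :
  (forall p q, delta0 p -> delta0 q -> delta0 (fop p q)) ->
  (forall (M : structure) (v : nat -> M) p q,
     sat v (fop p q) = op (sat v p) (sat v q)) ->
  regular R1 -> regular R2 -> regular (fun M v => op (R1 M v) (R2 M v)).
Proof.
move=> Dop Sop [Q1 [psi1 [q1 [[D1 T1 [F1 E1]] H1]]]].
move=> [Q2 [psi2 [q2 [[D2 T2 [F2 E2]] H2]]]].
exists (Q1 * Q2)%type, (fun q => fop (psi1 q.1) (psi2 q.2)), (q1, q2); split.
  split=> [q|a q Ha|]; first exact: Dop.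
    have [r1 Hr1] := T1 a q.1 Ha; have [r2 Hr2] := T2 a q.2 Ha.
    exists (r1, r2) => M v HM /=.
    by rewrite !Sop (propext (Hr1 M v HM)) (propext (Hr2 M v HM)).
  exists (fun q => op (F1 q.1) (F2 q.2)) => M q HM.
  by rewrite Sop (propext (E1 M q.1 HM)) (propext (E2 M q.2 HM)).
by move=> M v HM; rewrite Sop (propext (H1 M v HM)) (propext (H2 M v HM)).
Qed.

Lemma regular_and R1 R2 :
  regular R1 -> regular R2 -> regular (fun M v => R1 M v /\ R2 M v).
Proof. by apply: (@regular_connective fAnd) => // *; constructor. Qed.

Lemma regular_or R1 R2 :
  regular R1 -> regular R2 -> regular (fun M v => R1 M v \/ R2 M v).
Proof. by apply: (@regular_connective fOr) => // *; constructor. Qed.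

Lemma regular_imp R1 R2 :
  regular R1 -> regular R2 -> regular (fun M v => R1 M v -> R2 M v).
Proof.
by apply: (@regular_connective fImp (fun A B => A -> B)) => // *; constructor.
Qed.

Lemma regular_false : regular (fun _ _ => False).
Proof.
exists unit, (fun _ => fBot), tt; split=> //; split=> [_|a [] _|].
- by constructor.
- by exists tt.
- by exists (fun _ => False).
Qed.

Lemma regular_rename (f : nat -> nat) (R : forall M : structure, (nat -> M) -> Prop) :
  regular R -> regular (fun M v => R M (fun i => v (f i))).
Proof.
move=> [Q [psi [q0 [[D T [F E]] H]]]].
pose s i := tVar (f i).
exists Q, (fun q => fsubst s (psi q)), q0; split=> [|M v HM].
  split=> [q|a q Ha|]; first exact: delta0_fsubst.
    have [q' Hq'] := T (fun i => a (f i)) q (fun i => Ha (f i)).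
    exists q' => M v HM; rewrite !sat_fsubst; exact: (Hq' M (fun i => v (f i))).
  by exists F => M q HM; rewrite -(E M q HM) sat_fsubst.
by rewrite H // sat_fsubst.
Qed.

(** * Existential quantification *)

Section Projection.
Variables (Q : finType) (psi : Q -> formula) (Hpsi : kernel psi).

Lemma append_digit_surj (M : structure) (HM : model k M) (v : nat -> M) :
  exists w a, is_digits a /\ v = append_digit w a.
Proof.
have [w Hw] := choice (fun i => euclid_exists HM (v i)).
have [a Ha] := choice Hw.
exists w, a; split=> [i|]; first by have [] := Ha i.
by apply: funext => i; have [] := Ha i.
Qed.

(** Appending the digit b to the witness alone: the parameters stay 0. *)
Lemma witness_derivative b q : b < k -> exists q', forall (M : structure) (y : M),
  model k M ->
  sat (scons (sadd (smul k y) (snum M b)) (zero_val M)) (psi q) <->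
  sat (scons y (zero_val M)) (psi q').
Proof.
have [_ T _] := Hpsi => lt_bk.
have [|q' Hq'] := T (scons b (fun _ => 0)) q; first exact: is_digits_scons.
exists q' => M y HM; rewrite -(Hq' _ _ HM) append_digit_scons.
by rewrite append_digit_zero.
Qed.

(** A standard number has finitely many digits; reading them all reduces the claim
    to the value 0, where it is part of the definition of a kernel. *)
Lemma kernel_snum_absolute (M1 M2 : structure) n q : model k M1 -> model k M2 ->
  sat (scons (snum M1 n) (zero_val M1)) (psi q) <->
  sat (scons (snum M2 n) (zero_val M2)) (psi q).
Proof.
move=> HM1 HM2; have [_ _ [F E]] := Hpsi.
elim/ltn_ind: n q => n IH q; have [->|n0] := posnP n.
  have Z (M : structure) : scons (snum M 0) (zero_val M) = zero_val M.
    by apply: funext => -[].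
  by rewrite !Z (E M1) // (E M2).
have [|q' Hq'] := @witness_derivative (n %% k) q; first by rewrite ltn_mod.
have step (M : structure) : model k M ->
    sat (scons (snum M n) (zero_val M)) (psi q) <->
    sat (scons (snum M (n %/ k)) (zero_val M)) (psi q').
  move=> HM; rewrite -Hq' // (smul_snum HM) -(snumD HM) mulnC -divn_eq //.
by rewrite step // step //; apply: IH; rewrite ltn_Pdiv.
Qed.

(** The state is accepting for some standard witness when the parameters are 0. *)
Definition live (q : Q) : Prop :=
  exists n : nat, sat (scons (n : N) (zero_val N)) (psi q).

(** Induction on the power d for the bounded formula saying that no y <= d
    satisfies a state that is not live. All such states are treated at once, since
    stripping the last digit of y changes the state. *)
Lemma live_of_model (M : structure) (HM : model k M) q (y : M) :
  sat (scons y (zero_val M)) (psi q) -> live q.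
Proof.
have [D _ _] := Hpsi.
pose dead := [set q | ~~ `[< live q >]].
pose theta := fAllLe (tVar 0) (fConj dead (fun q =>
  fNot (fsubst (scons (tVar 0) (fun _ => tZero)) (psi q)))).
have Dtheta : delta0 theta.
  by do 2?constructor; apply: delta0_conj => r; do 2?constructor; apply: delta0_fsubst.
have thetaP d : sat (scons d (zero_val M)) theta <->
    forall y, sle y d -> forall q, sat (scons y (zero_val M)) (psi q) -> live q.
  rewrite sat_fAllLe; split=> H z Hz.
    move=> r Hr; apply: contrapT => nlive; move: (H z Hz); rewrite sat_conj.
    move=> /(_ r); rewrite inE => /(_ _)[]; first exact/asboolPn.
    by apply/sat_fsubst; congr sat: Hr; apply: funext => -[].
  rewrite sat_conj => r; rewrite inE => /asboolPn nlive /sat_fsubst Hr.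
  by apply/nlive/(H z Hz); congr sat: Hr; apply: funext => -[].
have [d [Pd le_yd _]] := power_cover hk HM y.
suff /thetaP H : sat (scons d (zero_val M)) theta by apply: H.
apply: (power_induction HM) Pd => //.
  apply/thetaP => z /(sle_snum HM)[n _ ->] r.
  rewrite (kernel_snum_absolute _ _ HM (standard_model hk)) => Hr; exists n.
  by rewrite snum_standard in Hr.
move=> e Pe /thetaP IH; apply/thetaP => z Hz r Hr.
have [z' [b [lt_bk Ez]]] := euclid_exists HM z.
have [r' Hr'] := witness_derivative r lt_bk.
have [||n Hn] := IH z' _ r'.
- by apply: (quotient_le_power hk HM lt_bk); rewrite -Ez.
- by apply/Hr'; rewrite // -Ez.
exists (@sadd N (smul k (n : N)) (snum N b)).
exact: (proj2 (Hr' N n (standard_model hk)) Hn).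
Qed.

Lemma live_bound : exists K, forall q, live q ->
  exists2 n, n < K & forall M : structure, model k M ->
    sat (scons (snum M n) (zero_val M)) (psi q).
Proof.
have [f Hf] : {f : Q -> nat & forall q, live q ->
    sat (scons (f q : N) (zero_val N)) (psi q)}.
  apply: (@choice Q nat (fun q n => live q ->
    sat (scons (n : N) (zero_val N)) (psi q))) => q.
  by have [[n Hn]|nl] := EM (live q); [exists n | exists 0].
exists (\max_q f q).+1 => q /Hf Hq; exists (f q); first exact: leq_bigmax.
move=> M HM; apply/(kernel_snum_absolute _ _ HM (standard_model hk)).
by rewrite snum_standard.
Qed.

(** The states depend on the witness, variable 0, and on fewer than nvar
    parameters, or on nothing at all if nvar is 0. *)
Let nvar : nat := \max_q fbound (psi q).

Lemma sat_params_agree (M : structure) (v w : nat -> M) y q :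
  (forall i, i < nvar -> v i = w i) ->
  sat (scons y v) (psi q) <-> sat (scons y w) (psi q).
Proof.
move=> H; apply: sat_agree => -[|i] //= Hi; apply: H.
by apply: leq_trans (leq_bigmax q); apply: ltnW.
Qed.

(** The bound is strict because of [append_digit_lt]. *)
Definition small_witness K (M : structure) (d : M) (x : nat -> M) (q : Q) : Prop :=
  exists2 y, sle (ssucc y) (smul K d) & sat (scons y x) (psi q).

Let small_witness_formula K (q : Q) : formula :=
  fExLe (tmul K (tVar nvar.+1))
    (fAnd (fLe (tSucc (tVar 0)) (tmul K (tVar nvar.+2)))
          (fsubst (scons (tVar 0) (fun i => tVar i.+2)) (psi q))).

(** The induction formula for [small_witness_exists], with d as variable 0 and
    the bound Y on the given witness as variable 1. Below the block of quantifiers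
    over the entries of x these are the variables nvar and nvar + 1. *)
Let bounding K : formula :=
  fAllLes nvar (tVar 0) (fAllLe (tVar nvar.+1) (fConj setT (fun q =>
    fImp (psi q) (small_witness_formula K q)))).

Let sat_params_prefix (M : structure) (x v : nat -> M) y q :
  sat (scons y (prefix_val nvar x v)) (psi q) <-> sat (scons y x) (psi q).
Proof. by apply: sat_params_agree => i Hi; rewrite /prefix_val Hi. Qed.

Let sat_small_witness (M : structure) (HM : model k M) K (d y : M) x v q :
  sat (scons y (prefix_val nvar x (scons d v))) (small_witness_formula K q) <->
  small_witness K d x q.
Proof.
have val_d : prefix_val nvar x (scons d v) nvar = d.
  by rewrite /prefix_val ltnn subnn.
have E z : sat (scons z (scons y (prefix_val nvar x (scons d v))))
    (fsubst (scons (tVar 0) (fun i => tVar i.+2)) (psi q)) <->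
    sat (scons z x) (psi q).
  rewrite sat_fsubst -(sat_params_prefix x (scons d v)).
  suff -> : (fun i => teval (scons z (scons y (prefix_val nvar x (scons d v))))
      (scons (tVar 0) (fun i => tVar i.+2) i)) =
      scons z (prefix_val nvar x (scons d v)) by [].
  by apply: funext => -[].
rewrite sat_fExLe teval_tmul /= val_d.
split=> [[z _ []]|[z lt_z Hz]]; last (exists z; last split).
- by rewrite E teval_tmul /= val_d; exists z.
- apply: (sle_trans HM) lt_z; rewrite (ssuccE HM) (sadd_comm HM).
  exact: (sle_addn HM).
- by rewrite teval_tmul /= val_d.
- by rewrite E.
Qed.

Let sat_bounding (M : structure) (HM : model k M) K (d Y : M) :
  sat (scons d (fun _ => Y)) (bounding K) <->
  forall x : nat -> M, (forall i, sle (x i) d) -> forall y, sle y Y ->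
    forall q, sat (scons y x) (psi q) -> small_witness K d x q.
Proof.
rewrite /bounding sat_fAllLes.
have body x : sat (prefix_val nvar x (scons d (fun _ => Y)))
    (fAllLe (tVar nvar.+1) (fConj setT (fun q =>
       fImp (psi q) (small_witness_formula K q)))) <->
    forall y, sle y Y -> forall q, sat (scons y x) (psi q) -> small_witness K d x q.
  have val_Y : prefix_val nvar x (scons d (fun _ => Y)) nvar.+1 = Y.
    by rewrite /prefix_val ltnNge leqnSn subSnn.
  rewrite sat_fAllLe [teval _ _]/= val_Y; split=> H y /H{}H.
    move=> q Hq; apply/(sat_small_witness HM K d y x (fun _ => Y) q).
    by move: H; rewrite sat_conj => /(_ q (in_setT q)); apply; apply/sat_params_prefix.
  rewrite sat_conj => q _ Hq; apply/(sat_small_witness HM).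
  exact: (H q (proj1 (sat_params_prefix x _ y q) Hq)).
split=> [H x Hx|H x Hx]; first by apply/body/H.
pose x' i := if i < nvar then x i else szero M.
have agree i : i < nvar -> x' i = x i by rewrite /x' => ->.
apply/body => y le_y q /(sat_params_agree _ _ agree) Hq.
have [|y' lt_y' Hy'] := H x' _ y le_y q Hq.
  by move=> i; rewrite /x'; case: ifP => [/Hx//|_]; apply: (sle0x HM).
by exists y' => //; apply/(sat_params_agree _ _ agree).
Qed.

(** For d = 1 the entries of x are single digits. Stripping them leaves the
    parameters 0, so that the state reached is live and has a standard witness less
    than some K0; appending the digit of y again gives the constant k * K0. In the
    step, a digit is stripped from x and from y, the induction hypothesis replaces
    the quotient of y by a small one, and the digit of y is put back. *)
Lemma small_witness_exists : exists K, forall (M : structure) (d y : M) x q,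
  model k M -> is_power d -> (forall i, sle (x i) d) ->
  sat (scons y x) (psi q) -> small_witness K d x q.
Proof.
have [D T _] := Hpsi; have [K0 HK0] := live_bound.
exists (k * K0) => M d Y x q HM Pd Hx Hq; set K := k * K0.
have DK : delta0 (bounding K).
  apply: delta0_fAllLes; constructor; apply: delta0_conj => r.
  constructor => //; constructor; constructor; first by constructor.
  exact: delta0_fsubst.
suff /(sat_bounding HM) H : sat (scons d (fun _ => Y)) (bounding K).
  by apply: H Hq => //; apply: (sle_refl HM).
apply: (power_induction HM) Pd => // {d q x Hx Hq}.
  apply/(sat_bounding HM) => x Hx y _ q Hq.
  have /choice[e He] i : exists b, b <= 1 /\ x i = snum M b.
    by have [b] := sle_snum HM (Hx i); exists b.
  have Ha : is_digits e by move=> i; have [/leq_ltn_trans->] := He i.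
  have Ex : x = append_digit (zero_val M) e.
    by rewrite append_digit_zero //; apply: funext => i; have [] := He i.
  have [y1 [b [lt_bk Ey]]] := euclid_exists HM y.
  have [q' Hq'] := T (scons b e) q (is_digits_scons lt_bk Ha).
  move: Hq; rewrite Ex Ey -append_digit_scons Hq' // => /(live_of_model HM).
  move=> /HK0[n lt_n /(_ M HM) Hn].
  exists (sadd (smul k (snum M n)) (snum M b)).
    rewrite !(smul_snum HM) -(snumD HM) muln1.
    by apply: (@snum_le _ _ HM (k * n + b).+1); rewrite /K; nia.
  by rewrite -append_digit_scons Hq'.
move=> d Pd /(sat_bounding HM) IH; apply/(sat_bounding HM) => x Hx y le_y q Hq.
have [w [a [Ha Ex]]] := append_digit_surj HM x.
have [y1 [b [lt_bk Ey]]] := euclid_exists HM y.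
have [q' Hq'] := T (scons b a) q (is_digits_scons lt_bk Ha).
move: Hq; rewrite Ex Ey -append_digit_scons Hq' // => /IH[i||z lt_z Hz].
- by apply: (quotient_le_power hk HM (Ha i)); have := Hx i; rewrite Ex.
- by apply: (sle_trans HM) le_y; rewrite Ey; apply: (quotient_le hk HM).
exists (sadd (smul k z) (snum M b)); first exact: (append_digit_lt HM).
by rewrite -append_digit_scons Hq'.
Qed.

Fixpoint sum_vars (n : nat) : term :=
  if n is n1.+1 then tAdd (tVar n1) (sum_vars n1) else tZero.

Lemma sle_sum_vars (M : structure) (HM : model k M) (v : nat -> M) n i :
  i < n -> sle (v i) (teval v (sum_vars n)).
Proof.
elim: n => // n IH; rewrite ltnS leq_eqVlt => /orP[/eqP->|/IH H] /=.
  by rewrite (sadd_comm HM); apply: (sle_addn HM).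
exact/(sle_trans HM H)/(sle_addn HM).
Qed.

Definition witness_bound (K : nat) : term :=
  tmul K (tAdd (tmul k (sum_vars nvar)) (num 1)).

(** Apply [small_witness_exists] to a power d of k above the sum of the parameters
    with d at most k times this sum plus 1. *)
Lemma bounded_witness : exists K, forall (M : structure) (v : nat -> M) q,
  model k M -> (exists y, sat (scons y v) (psi q)) ->
  exists2 y, sle y (teval v (witness_bound K)) & sat (scons y v) (psi q).
Proof.
have [K HK] := small_witness_exists; exists K => M v q HM [y Hy].
pose w i := if i < nvar then v i else szero M.
have agree i : i < nvar -> v i = w i by rewrite /w => ->.
have [d [Pd le_d d_le]] := power_cover hk HM (teval v (sum_vars nvar)).
have [||z lt_z Hz] := HK M d y w q HM Pd.
- move=> i; rewrite /w; case: ifP => [lt_i|_]; last exact: (sle0x HM).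
  exact/(sle_trans HM _ le_d)/(sle_sum_vars HM).
- exact/(sat_params_agree _ _ agree).
exists z; last exact/(sat_params_agree _ _ agree).
apply: (@sle_trans _ _ HM (ssucc z)).
  by rewrite (ssuccE HM) (sadd_comm HM); apply: (sle_addn HM).
apply: (sle_trans HM lt_z); rewrite teval_tmul /= teval_tmul.
exact: (smul_le HM).
Qed.

(** The subset construction: reading the digits a from a set S of states leads to
    all the states reached from S by a together with some digit of the witness. *)
Lemma kernel_projection : exists psi' : {set Q} -> formula, kernel psi' /\
  forall (M : structure) (v : nat -> M) S, model k M ->
    sat v (psi' S) <-> exists y, exists2 q, q \in S & sat (scons y v) (psi q).
Proof.
have [D T _] := Hpsi; have [K HK] := bounded_witness.
pose psi' (S : {set Q}) := fExLe (witness_bound K) (fDisj S psi).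
have psi'P (M : structure) (v : nat -> M) S : model k M ->
    sat v (psi' S) <-> exists y, exists2 q, q \in S & sat (scons y v) (psi q).
  move=> HM; rewrite sat_fExLe; split=> [[y _ /sat_disj H]|[y [q qS Hq]]].
    by exists y.
  have [z le_z Hz] := HK M v q HM (ex_intro _ y Hq).
  by exists z => //; apply/sat_disj; exists q.
exists psi'; split=> //; split=> [S|a S Ha|].
- by constructor; apply: delta0_disj.
- exists [set q' | `[< exists q b, [/\ q \in S, b < k &
      derivative (scons b a) (psi q) (psi q')] >]].
  move=> M v HM; rewrite !psi'P //; split=> [[y [q qS Hq]]|[y [q']]].
    have [z [b [lt_bk Ey]]] := euclid_exists HM y.
    have [q' Hq'] := T (scons b a) q (is_digits_scons lt_bk Ha).
    exists z, q'; first by rewrite inE; apply/asboolP; exists q, b.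
    by rewrite -Hq' // append_digit_scons -Ey.
  rewrite inE => /asboolP[q [b [qS lt_bk Hq']]] Hy.
  exists (sadd (smul k y) (snum M b)), q => //.
  by rewrite -append_digit_scons Hq'.
exists (fun S : {set Q} => exists2 q, q \in S & live q) => M S HM; rewrite psi'P //.
split=> [[y [q qS /(live_of_model HM)]]|[q qS]]; first by exists q.
have [K0 HK0] := live_bound => /HK0[n _ Hn].
by exists (snum M n), q => //; apply: Hn.
Qed.

End Projection.

Lemma regular_ex R :
  regular R -> regular (fun M v => exists x, R M (scons x v)).
Proof.
move=> [Q [psi [q0 [Hpsi H]]]].
have [psi' [Hpsi' psi'P]] := kernel_projection Hpsi.
exists {set Q}, psi', [set q0]; split=> // M v HM; rewrite psi'P //.
split=> [[x Hx]|[x [q]]]; first by exists x, q0; rewrite ?inE -?H.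
by rewrite inE => /eqP->; exists x; rewrite H.
Qed.

(** * Every formula is regular *)

(** The states are the two carries and a rejecting sink. *)
Lemma regular_add_carry (c : bool) :
  regular (fun M v => v 0 = sadd (sadd (v 1) (v 2)) (snum M c)).
Proof.
pose psi (q : option bool) : formula :=
  if q is Some e then fEq (tVar 0) (tAdd (tAdd (tVar 1) (tVar 2)) (num e))
  else fBot.
exists (option bool), psi, (Some c); split=> [|M v HM]; last by rewrite /= teval_num.
split=> [[e|]|a [e|] Ha|]; try by constructor.
- pose t := a 1 + a 2 + e.
  have Et : t %/ k = (k <= t).
    have lt_t : t < 2 * k.
      by rewrite /t; have := Ha 1; have := Ha 2; case: e @t => /=; lia.
    case: leqP => [le_kt|/divn_small->//].
    by apply/eqP; rewrite eqn_leq -ltnS ltn_divLR // lt_t leq_divRL // mul1n.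
  exists (if a 0 == t %% k then Some (k <= t) else None) => M v HM.
  rewrite /= teval_num (add_digits hk HM) // -/t.
  case: eqP => [->|ne_a0] /=; last by split=> // -[].
  by rewrite teval_num Et; split=> [[]|].
- by exists None.
exists (fun q => q = Some false) => M [e|] HM //=.
rewrite teval_num !(sadd_zero HM) (szero_add HM).
by case: e; split=> // /(@snum_inj _ _ HM 0 1).
Qed.

(** Obtained from addition, as x = x + x only for x = 0 *)
Lemma regular_zero : regular (fun M v => v 0 = szero M).
Proof.
apply: regular_ext (regular_rename (fun _ => 0) (regular_add_carry false)).
move=> M v HM; rewrite /= (sadd_zero HM); split=> [|->]; last by rewrite (sadd_zero HM).
by rewrite -{1}(szero_add HM (v 0)) => /(sadd_cancel HM).
Qed.

(** While only zeros of x have been read, the state [Some true] requires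
    V_k(x) = y; the first nonzero digit of x must meet the digit 1 of y, and then
    [Some false] requires the rest of y to be 0. *)
Lemma regular_V : regular (fun M v => v 0 = sV (v 1)).
Proof.
pose psi (q : option bool) : formula :=
  if q is Some e then fEq (tVar 0) (if e then tV (tVar 1) else tZero) else fBot.
exists (option bool), psi, (Some true); split=> //.
have euclidP (M : structure) (y x : M) b c : model k M -> b < k -> c < k ->
    sadd (smul k y) (snum M b) = sadd (smul k x) (snum M c) <-> y = x /\ b = c.
  by move=> HM lt_bk lt_ck; split=> [/(euclid_unique HM lt_bk lt_ck)|[-> ->]].
have quotient0 (M : structure) (y : M) b c : model k M -> b < k -> c < k ->
    sadd (smul k y) (snum M b) = snum M c <-> y = szero M /\ b = c.
  move=> HM lt_bk lt_ck; rewrite -(euclidP _ y) //.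
  by rewrite (smul_zero HM) (szero_add HM).
split=> [[e|]|a [[]|] Ha|]; try by constructor.
- have [a1|a1] := posnP (a 1).
    exists (if a 0 == 0 then Some true else None) => M v HM.
    have := euclidP M (v 0) (sV (v 1)) (a 0) 0 HM (Ha 0) k_gt0.
    rewrite /= /append_digit a1 !(sadd_zero HM) (sV_mul HM) => ->.
    by case: eqP => [->|ne_a0] /=; split=> // -[].
  exists (if a 0 == 1 then Some false else None) => M v HM.
  rewrite /= /append_digit (sV_digit hk HM) ?a1 ?Ha // quotient0 //.
  by case: eqP => [->|ne_a0] /=; split=> // -[].
- exists (if a 0 == 0 then Some false else None) => M v HM.
  rewrite /= /append_digit -[szero M]/(snum M 0) quotient0 //.
  by case: eqP => [->|ne_a0] /=; split=> // -[].
- by exists None.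
by exists (fun q => q <> None) => M [[]|] HM /=; rewrite ?(sV_zero HM).
Qed.

Lemma regular_eq : regular (fun M v => v 0 = v 1).
Proof.
apply: regular_ext (regular_ex (regular_and regular_zero
  (regular_rename (fun i => nth 0 [:: 1; 2; 0] i) (regular_add_carry false)))).
move=> M v HM /=; split=> [[x [-> ->]]|->]; first by rewrite !(sadd_zero HM).
by exists (szero M); rewrite !(sadd_zero HM).
Qed.

Lemma regular_succ : regular (fun M v => v 0 = ssucc (v 1)).
Proof.
apply: regular_ext (regular_ex (regular_and regular_zero
  (regular_rename (fun i => nth 0 [:: 1; 2; 0] i) (regular_add_carry true)))).
move=> M v HM /=; rewrite (ssuccE HM (v 1)); split=> [[x [-> ->]]|->].
  by rewrite !(sadd_zero HM).
by exists (szero M); rewrite !(sadd_zero HM).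
Qed.

Lemma regular_add : regular (fun M v => v 0 = sadd (v 1) (v 2)).
Proof.
apply: regular_ext (regular_add_carry false) => M v HM.
by rewrite /= (sadd_zero HM).
Qed.

Lemma regular_le : regular (fun M v => sle (v 0) (v 1)).
Proof.
apply: regular_ext (regular_ex
  (regular_rename (fun i => nth 0 [:: 2; 0; 1] i) regular_add)).
by move=> M v HM /=; rewrite (sle_add_exists HM).
Qed.

(** Terms are flattened: the values of subterms are existentially quantified. *)
Lemma regular_term t :
  regular (fun M v => v 0 = teval (fun i => v i.+1) t).
Proof.
pose skip i := if i is j.+1 then j.+2 else 0.
pose skip1 i := if i is j.+1 then j.+3 else 1.
pose skip0 i := if i is j.+1 then j.+3 else 0.
elim: t => [j||t IH|t IHt u IHu|t IH] /=.
- exact: (regular_rename (fun i => if i is 0 then 0 else j.+1) regular_eq).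
- exact: regular_zero.
- apply: regular_ext (regular_ex (regular_and (regular_rename skip IH)
    (regular_rename (fun i => nth 0 [:: 1; 0] i) regular_succ))).
  by move=> M v HM /=; split=> [[x [-> ->]]|->] //; exists (teval (fun i => v i.+1) t).
- apply: regular_ext (regular_ex (regular_ex (regular_and
    (regular_and (regular_rename skip0 IHt) (regular_rename skip1 IHu))
    (regular_rename (fun i => nth 0 [:: 2; 0; 1] i) regular_add)))).
  move=> M v HM /=; split=> [[x [y [[-> ->] ->]]]|->] //.
  by exists (teval (fun i => v i.+1) u), (teval (fun i => v i.+1) t).
- apply: regular_ext (regular_ex (regular_and (regular_rename skip IH)
    (regular_rename (fun i => nth 0 [:: 1; 0] i) regular_V))).
  by move=> M v HM /=; split=> [[x [-> ->]]|->] //; exists (teval (fun i => v i.+1) t).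
Qed.

Lemma regular_sat phi : regular (fun M v => sat v phi).
Proof.
pose skip1 i := if i is j.+1 then j.+2 else 1.
pose skip0 i := if i is j.+1 then j.+2 else 0.
elim: phi => [t u|t u||p IHp q IHq|p IHp q IHq|p IHp q IHq|p IHp|p IHp] /=.
- apply: regular_ext (regular_ex (regular_and (regular_term t) (regular_term u))).
  move=> M v HM /=; split=> [[x [<- <-]]|E] //.
  by exists (teval v t).
- apply: regular_ext (regular_ex (regular_ex (regular_and
    (regular_and (regular_rename skip0 (regular_term t))
                 (regular_rename skip1 (regular_term u))) regular_le))).
  move=> M v HM /=; split=> [[x [y [[-> ->]]]]|le_tu] //.
  by exists (teval v u), (teval v t).
- exact: regular_false.
- exact: regular_and.
- exact: regular_or.
- exact: regular_imp.
- apply: regular_ext (regular_imp (regular_ex (regular_imp IHp regular_false))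
    regular_false).
  move=> M v HM /=; split=> [H x|H [x]]; last exact.
  by apply: contrapT => nHx; apply: H; exists x.
- exact: (regular_ex IHp).
Qed.

Lemma sentence_absolute phi (M1 M2 : structure) : sentence phi ->
  model k M1 -> model k M2 -> models M1 phi -> models M2 phi.
Proof.
move=> phi0 HM1 HM2 H v.
have [Q [psi [q0 [[_ _ [F E]] Hphi]]]] := regular_sat phi.
have agree : forall i, i < fbound phi -> v i = zero_val M2 i by rewrite phi0.
rewrite (sat_agree agree) Hphi // E // -(E M1) // -Hphi //; exact: H.
Qed.

End Regular.

Theorem mainTheorem3 (k : nat) (hk : 2 <= k) (phi : formula)
    (hphi : sentence phi) :
  consequence (axioms k) phi <-> BA k phi.
Proof.
have HN := standard_model hk; split=> [H|[_ H] M HM]; first by split=> //; apply: H.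
exact: (sentence_absolute hk hphi HN HM H).
Qed.
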